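(* Let $p$ be a prime number and let $F$ be a field of characteristic $p$. For every class $(a,b)\in H^1_{p^2}(F)$ (with $a,b\in F$), there exists a finite field extension $L/F$ of degree prime to $p$ and at most $p^2-p+1$ such that $(a,b)_L=(c,0)$ in $H^1_{p^2}(L)$ for some $c\in L$.
   Context: $W_2F$ denotes the ring of ($p$-typical) truncated Witt vectors of length $2$ over $F$; its elements are pairs $(a,b)$ with $a,b\in F$. The group $H^1_{p^2}(F)$ is $W_2F/\wp(W_2F)$, where $\wp(\omega)=\omega^p-\omega$, with $\omega^p$ standing for $(\omega_1^p,\omega_2^p)$ when $\omega=(\omega_1,\omega_2)$, and the subtraction being that of $W_2F$. The class of the vector $(a,b)$ is again denoted $(a,b)$, and $(a,b)_L$ is its image in $H^1_{p^2}(L)$ under the map induced by $F\subseteq L$. *)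

(* Defs.v *)
From HB Require Import structures.
From mathcomp Require Import all_boot all_order all_algebra all_field.
From mathcomp Require Import boolp.
From mathcomp Require Import ring.

Set Implicit Arguments.
Unset Strict Implicit.
Unset Printing Implicit Defensive.

Import GRing.Theory Num.Theory.
Local Open Scope ring_scope.

(* (x + y)^p = x^p + y^p + p * witt_carry p x y for p prime. *)
Definition witt_carry (p : nat) (R : pzRingType) (x y : R) : R :=
  \sum_(1 <= i < p) x ^+ i * y ^+ (p - i) *+ ('C(p, i) %/ p).

Lemma witt_carryE (p : nat) (R : comNzRingType) (x y : R) : prime p ->
  (x + y) ^+ p = x ^+ p + y ^+ p + witt_carry p x y *+ p.
Proof.
move=> p_pr; have p_gt0 := prime_gt0 p_pr.
rewrite addrC exprDn -(big_mkord xpredT (fun i => y ^+ (p - i) * x ^+ i *+ 'C(p, i))).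
rewrite big_nat_recr //= big_ltn //= bin0 binn subn0 subnn !expr0 mulr1 mul1r.
rewrite !mulr1n addrC addrA; congr (_ + _).
rewrite /witt_carry -sumrMnl; apply: eq_big_nat => i /andP[i_gt0 i_lt].
by rewrite mulrC -mulrnA divnK // prime_dvd_bin // i_gt0.
Qed.

Lemma witt_carryC (p : nat) (R : comNzRingType) (x y : R) : prime p ->
  witt_carry p x y = witt_carry p y x.
Proof.
move=> p_pr; rewrite /witt_carry big_nat_rev /=.
apply: eq_big_nat => i /andP[i_gt0 i_lt].
by rewrite add1n subSS subKn ?(ltnW i_lt) // bin_sub ?(ltnW i_lt) // mulrC.
Qed.

Lemma witt_carry0 (p : nat) (R : comNzRingType) (x : R) : witt_carry p 0 x = 0.
Proof.
rewrite /witt_carry big_nat big1 // => i /andP[i_gt0 _].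
by rewrite expr0n gtn_eqF // mul0r mul0rn.
Qed.

Lemma witt_carryM (p : nat) (R : comNzRingType) (a x y : R) :
  witt_carry p (a * x) (a * y) = a ^+ p * witt_carry p x y.
Proof.
rewrite /witt_carry mulr_sumr; apply: eq_big_nat => i /andP[_ i_lt].
by rewrite !exprMn mulrACA -exprD subnKC ?(ltnW i_lt) // mulrnAr.
Qed.

Lemma rmorph_witt_carry (p : nat) (R S : comNzRingType)
    (f : {rmorphism R -> S}) (x y : R) :
  f (witt_carry p x y) = witt_carry p (f x) (f y).
Proof.
rewrite /witt_carry rmorph_sum; apply: eq_bigr => i _.
by rewrite rmorphMn rmorphM !rmorphXn.
Qed.

Lemma poly_rmorph_ext (A R : comNzRingType) (g : {rmorphism A -> R}) (r : R) :
  exists h : {rmorphism {poly A} -> R}, h 'X = r /\ forall a, h a%:P = g a.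
Proof.
have cgr : commr_rmorph g r by move=> a; apply: mulrC.
exists (horner_morph cgr); split; first exact: horner_morphX.
by move=> a; apply: horner_morphC.
Qed.

(* The cocycle identity is checked where p is not a zero divisor, then
   specialised from Z[X, Y, Z]. *)
Lemma witt_carryA_idomain (p : nat) (R : idomainType) (x y z : R) :
  prime p -> p%:R != 0 :> R ->
  witt_carry p x y + witt_carry p (x + y) z =
  witt_carry p y z + witt_carry p x (y + z).
Proof.
move=> p_pr p_neq0; apply: (mulIf p_neq0).
have E (a b : R) :
    witt_carry p a b * p%:R = (a + b) ^+ p - a ^+ p - b ^+ p.
  by rewrite witt_carryE // mulr_natr; move: (_ *+ p) => w; ring.
rewrite !mulrDl !E [x + (y + z)]addrA.
move: ((x + y + z) ^+ p) ((x + y) ^+ p) ((y + z) ^+ p) => s t u.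
ring.
Qed.

Lemma witt_carryA (p : nat) (R : comNzRingType) (x y z : R) : prime p ->
  witt_carry p x y + witt_carry p (x + y) z =
  witt_carry p y z + witt_carry p x (y + z).
Proof.
move=> p_pr.
have [h1 [h1X _]] := poly_rmorph_ext (intr : {rmorphism int -> R}) x.
have [h2 [h2X h2C]] := poly_rmorph_ext h1 y.
have [h3 [h3X h3C]] := poly_rmorph_ext h2 z.
have [P [h [X [Y [Z [P0 [hX hY hZ]]]]]]] :
    exists (P : idomainType) (h : {rmorphism P -> R}) (X Y Z : P),
      p%:R != 0 :> P /\ [/\ h X = x, h Y = y & h Z = z].
  exists {poly {poly {poly int}}}, h3, 'X%:P%:P, 'X%:P, 'X.
  split; last by split=> //; rewrite ?h3C ?h2C.
  by rewrite -!polyC_natr !polyC_eq0 pnatr_eq0 -lt0n prime_gt0.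
have := congr1 h (witt_carryA_idomain X Y Z p_pr P0).
by rewrite !(rmorphD h) !rmorph_witt_carry !(rmorphD h) hX hY hZ.
Qed.

(* W_2(R).  A record, because R * R already carries the componentwise ring
   structure. *)
Record witt2 (p : nat) (p_pr : prime p) (R : Type) :=
  Witt2 { witt2_0 : R; witt2_1 : R }.

Arguments Witt2 {p} p_pr {R} _ _.

Section Witt2Ring.
Variables (p : nat) (p_pr : prime p).

Definition witt2_pair (R : Type) (v : witt2 p_pr R) : R * R :=
  (witt2_0 v, witt2_1 v).
Definition pair_witt2 (R : Type) (u : R * R) : witt2 p_pr R :=
  Witt2 p_pr u.1 u.2.
Lemma witt2_pairK (R : Type) : cancel (@witt2_pair R) (@pair_witt2 R).
Proof. by case. Qed.

HB.instance Definition _ (R : choiceType) :=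
  Choice.copy (witt2 p_pr R) (can_type (@witt2_pairK R)).

Variable R : comNzRingType.
Local Notation W := (witt2 p_pr R).

Definition witt2_zero : W := Witt2 p_pr 0 0.
Definition witt2_one : W := Witt2 p_pr 1 0.

Definition witt2_add (v w : W) : W :=
  Witt2 p_pr (witt2_0 v + witt2_0 w)
    (witt2_1 v + witt2_1 w - witt_carry p (witt2_0 v) (witt2_0 w)).

Definition witt2_opp (v : W) : W :=
  Witt2 p_pr (- witt2_0 v) (- witt2_1 v + witt_carry p (witt2_0 v) (- witt2_0 v)).

Definition witt2_mul (v w : W) : W :=
  Witt2 p_pr (witt2_0 v * witt2_0 w)
    (witt2_0 v ^+ p * witt2_1 w + witt2_1 v * witt2_0 w ^+ p
     + witt2_1 v * witt2_1 w *+ p).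

Lemma witt2_addA : associative witt2_add.
Proof.
case=> a0 a1 [b0 b1] [c0 c1]; rewrite /witt2_add /=; congr Witt2.
  by rewrite addrA.
have E := witt_carryA a0 b0 c0 p_pr.
have -> : witt_carry p a0 (b0 + c0) =
    witt_carry p a0 b0 + witt_carry p (a0 + b0) c0 - witt_carry p b0 c0.
  by rewrite E; ring.
ring.
Qed.

Lemma witt2_addC : commutative witt2_add.
Proof.
case=> a0 a1 [b0 b1]; rewrite /witt2_add /=; congr Witt2; first exact: addrC.
by rewrite witt_carryC // [a1 + b1]addrC.
Qed.

Lemma witt2_add0 : left_id witt2_zero witt2_add.
Proof.
by case=> a0 a1; rewrite /witt2_add /= witt_carry0 subr0 !add0r.
Qed.

Lemma witt2_addN : left_inverse witt2_zero witt2_opp witt2_add.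
Proof.
case=> a0 a1; rewrite witt2_addC /witt2_add /=; congr Witt2; first exact: subrr.
by ring.
Qed.

HB.instance Definition _ :=
  GRing.isZmodule.Build W witt2_addA witt2_addC witt2_add0 witt2_addN.

Lemma witt2_mulA : associative witt2_mul.
Proof.
case=> a0 a1 [b0 b1] [c0 c1]; rewrite /witt2_mul /=; congr Witt2.
  by rewrite mulrA.
rewrite !exprMn; ring.
Qed.

Lemma witt2_mulC : commutative witt2_mul.
Proof.
case=> a0 a1 [b0 b1]; rewrite /witt2_mul /=; congr Witt2; first exact: mulrC.
ring.
Qed.

Lemma witt2_mul1 : left_id witt2_one witt2_mul.
Proof.
case=> a0 a1; rewrite /witt2_mul /= expr1n !mul1r !mul0r mul0rn !addr0 //.
Qed.

Lemma witt2_mulD : left_distributive witt2_mul witt2_add.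
Proof.
case=> a0 a1 [b0 b1] [c0 c1]; rewrite /witt2_mul /witt2_add /=.
congr Witt2; first exact: mulrDl.
rewrite ![_ * c0]mulrC witt_carryM witt_carryE //; ring.
Qed.

Lemma witt2_one_neq0 : witt2_one != 0.
Proof. by apply/eqP => -[/eqP]; rewrite oner_eq0. Qed.

HB.instance Definition _ :=
  GRing.Zmodule_isComNzRing.Build W witt2_mulA witt2_mulC witt2_mul1 witt2_mulD
    witt2_one_neq0.

End Witt2Ring.

(* omega |-> (omega_1^p, omega_2^p); this is not the p-th power of the ring
   W_2(R). *)
Definition witt2_frob (p : nat) (p_pr : prime p) (R : comNzRingType)
    (v : witt2 p_pr R) : witt2 p_pr R :=
  Witt2 p_pr (witt2_0 v ^+ p) (witt2_1 v ^+ p).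

Definition witt2_wp (p : nat) (p_pr : prime p) (R : comNzRingType)
    (v : witt2 p_pr R) : witt2 p_pr R :=
  witt2_frob v - v.

Definition witt2_map (p : nat) (p_pr : prime p) (R S : Type) (f : R -> S)
    (v : witt2 p_pr R) : witt2 p_pr S :=
  Witt2 p_pr (f (witt2_0 v)) (f (witt2_1 v)).

Lemma witt2_mapD (p : nat) (p_pr : prime p) (R S : comNzRingType)
    (f : {rmorphism R -> S}) :
  {morph @witt2_map p p_pr R S f : v w / v + w}.
Proof.
case=> a0 a1 [b0 b1]; congr Witt2; first exact: rmorphD.
by rewrite /= rmorphB rmorphD rmorph_witt_carry.
Qed.

Lemma witt2_mapB (p : nat) (p_pr : prime p) (R S : comNzRingType)
    (f : {rmorphism R -> S}) :
  {morph @witt2_map p p_pr R S f : v w / v - w}.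
Proof.
by move=> v w; apply: (addIr (witt2_map f w)); rewrite -witt2_mapD !subrK.
Qed.

Lemma witt2_map_frob (p : nat) (p_pr : prime p) (R S : comNzRingType)
    (f : {rmorphism R -> S}) (v : witt2 p_pr R) :
  witt2_map f (witt2_frob v) = witt2_frob (witt2_map f v).
Proof. by congr Witt2; apply: rmorphXn. Qed.

Lemma witt2_map_wp (p : nat) (p_pr : prime p) (R S : comNzRingType)
    (f : {rmorphism R -> S}) (v : witt2 p_pr R) :
  witt2_map f (witt2_wp v) = witt2_wp (witt2_map f v).
Proof. by rewrite /witt2_wp witt2_mapB witt2_map_frob. Qed.

Lemma witt2_frobB (p : nat) (p_pr : prime p) (R : comNzRingType) :
  p \in [pchar R] -> {morph @witt2_frob p p_pr R : v w / v - w}.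
Proof.
by move=> chR v w; apply: (witt2_mapB (pFrobenius_aut chR)).
Qed.

Section H1.
Variables (p : nat) (p_pr : prime p) (F : fieldType) (chF : p \in [pchar F]).

(* The argument chF is what makes the image of wp a subgroup. *)
Definition wp_image of p \in [pchar F] : {pred witt2 p_pr F} :=
  fun v => `[< exists w : witt2 p_pr F, v = witt2_wp w >].

Lemma wp_image_zmod_closed : zmod_closed (wp_image chF).
Proof.
split=> [|_ _ /asboolP[v ->] /asboolP[w ->]].
  by apply/asboolP; exists 0; rewrite /witt2_wp -[X in witt2_frob X](subrr 0)
    witt2_frobB // !subrr.
apply/asboolP; exists (v - w).
by rewrite /witt2_wp witt2_frobB // !opprB addrACA [LHS]addrC; ring.
Qed.

HB.instance Definition _ :=
  GRing.isZmodClosed.Build (witt2 p_pr F) (wp_image chF) wp_image_zmod_closed.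

(* H^1_{p^2}(F) = W_2 F / wp(W_2 F) *)
Definition H1p2 := Quotient.quot (wp_image chF).

Definition H1p2_class (a b : F) : H1p2 := (\pi_H1p2 (Witt2 p_pr a b))%qT.

Lemma H1p2_eqP (v w : witt2 p_pr F) :
  (\pi_H1p2 v = \pi_H1p2 w)%qT <-> exists u, v - w = witt2_wp u.
Proof.
split=> [/eqP|].
  by rewrite -Quotient.idealrBE => /asboolP.
by move=> vw; apply/eqP; rewrite -Quotient.idealrBE; apply/asboolP.
Qed.

End H1.

(* The map induced by f on H^1_{p^2}; it does not depend on the chosen
   representative (H1p2_map_class). *)
Definition H1p2_map (p : nat) (p_pr : prime p) (F L : fieldType)
    (chF : p \in [pchar F]) (f : {rmorphism F -> L})
    (x : H1p2 p_pr chF) : H1p2 p_pr (rmorph_pchar f chF) :=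
  (\pi_(H1p2 p_pr (rmorph_pchar f chF)) (witt2_map f (repr x)))%qT.

Lemma H1p2_map_class (p : nat) (p_pr : prime p) (F L : fieldType)
    (chF : p \in [pchar F]) (f : {rmorphism F -> L}) (a b : F) :
  H1p2_map f (H1p2_class p_pr chF a b) =
  H1p2_class p_pr (rmorph_pchar f chF) (f a) (f b).
Proof.
apply/H1p2_eqP.
have /H1p2_eqP[u Eu] :
    (\pi_(H1p2 p_pr chF) (repr (H1p2_class p_pr chF a b)) =
     \pi_(H1p2 p_pr chF) (Witt2 p_pr a b))%qT by exact: reprK.
by exists (witt2_map f u); rewrite -witt2_map_wp -Eu witt2_mapB.
Qed.

(* Main.v *)
(** Adding wp(u, 0) to (a, b) produces a vector whose second entry is the value
    at u of a polynomial over F of degree p^2 - p + 1, the leading monomial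
    coming from the term (u^p)^(p-1) u of a Witt carry.  That degree is prime to
    p, so some irreducible factor has degree prime to p, and adjoining one of its
    roots kills the second entry. *)

Require Import Defs.
From mathcomp Require Import all_boot all_order all_algebra all_field.
From mathcomp Require Import boolp zify.

Import GRing.Theory.
Local Open Scope ring_scope.

(** Strong induction on the size: in a proper factorization of [q] the two degrees add up to one
    prime to [p], so [p] cannot divide both, and one of the factors inherits the hypothesis. *)
Lemma irreducible_factor_coprime_degree (F : fieldType) (p : nat) (q : {poly F}) :
  prime p -> coprime (size q).-1 p ->
  exists r : {poly F},
    [/\ irreducible_poly r, r %| q & coprime (size r).-1 p].
Proof.
move=> p_pr; have [n] := ubnP (size q); elim: n q => // n IHn q /ltnSE size_q co_q.
(* Zero and nonzero constants both have [(size s).-1 = 0], and gcd(0, p) = p > 1. *)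
have size_gt1 (s : {poly F}) : coprime (size s).-1 p -> (1 < size s)%N.
  by rewrite ltnNge => co_s; apply: contraTN co_s; case: (size s) => [|[|//]] _ /=;
    rewrite /coprime gcd0n gtn_eqF ?prime_gt1.
have q_neq0 : q != 0 by rewrite -size_poly_gt0 ltnW ?size_gt1.
have [q_irr | q_red] := pselect (irreducible_poly q); first by exists q.
have [d [d_neq1 d_dvd d_neqp]] :
    exists d : {poly F}, [/\ size d != 1, d %| q & ~~ (d %= q)].
  apply: contrapT => no_div; apply: q_red; split=> [|d d1 dq].
    exact: size_gt1.
  by apply: contrapT => /negP dNq; apply: no_div; exists d.
have [e def_q] := dvdpP _ _ d_dvd.
have d_neq0 : d != 0 by apply: contraNneq q_neq0 => d0; rewrite def_q d0 mulr0.
have e_neq0 : e != 0 by apply: contraNneq q_neq0 => e0; rewrite def_q e0 mul0r.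
have d_lt : (size d < size q)%N.
  by rewrite ltn_neqAle dvdp_size_eqp // d_neqp dvdp_leq.
have d_gt1 : (1 < size d)%N by rewrite ltn_neqAle eq_sym d_neq1 size_poly_gt0.
have size_de : size q = (size e + size d).-1 by rewrite def_q size_mul.
have e_lt : (size e < size q)%N by rewrite size_de; lia.
have [co_d | nco_d] := boolP (coprime (size d).-1 p).
  have [r [irr_r r_dvd co_r]] := IHn d (leq_trans d_lt size_q) co_d.
  by exists r; split=> //; apply: dvdp_trans r_dvd d_dvd.
have co_e : coprime (size e).-1 p.
  have e_gt0 : (0 < size e)%N by rewrite size_poly_gt0.
  have deg_q : (size q).-1 = ((size e).-1 + (size d).-1)%N by lia.
  move: co_q nco_d; rewrite deg_q ![coprime _ p]coprime_sym !prime_coprime //.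
  by move=> + /negPn p_d; rewrite dvdn_addl.
have [r [irr_r r_dvd co_r]] := IHn e (leq_trans e_lt size_q) co_e.
by exists r; split=> //; rewrite def_q dvdp_mulr.
Qed.

Lemma exists_root_coprime_degree (F : fieldType) (p : nat) (q : {poly F}) :
  prime p -> coprime (size q).-1 p ->
  exists (L : fieldExtType F) (z : L),
    [/\ coprime (\dim {:L}) p, (\dim {:L} <= (size q).-1)%N
      & root (map_poly (in_alg L) q) z].
Proof.
move=> p_pr co_q.
have [r [irr_r r_dvd co_r]] := irreducible_factor_coprime_degree _ _ _ p_pr co_q.
have [L dimL [z z_root _]] := irredp_FAdjoin irr_r.
have q_neq0 : q != 0.
  apply: contraTneq co_q => ->.
  by rewrite size_poly0 /coprime gcd0n gtn_eqF ?prime_gt1.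
exists L, z; split; rewrite ?dimL //.
  by rewrite -!subn1 leq_sub2r ?dvdp_leq.
by apply: (root_dvdp _ z_root); rewrite dvdp_map.
Qed.

(* The polynomial in u whose value is the second entry of (a, b) + wp(u, 0). *)
Definition second_entry_poly (F : fieldType) (p : nat) (a b : F) : {poly F} :=
  witt_carry p (a%:P + 'X^p - 'X) 'X - witt_carry p a%:P 'X^p + b%:P.

(** With A = a + X^p - X, the term A^(p-1) X of the first carry has degree p(p-1) + 1 and strictly
    dominates everything else, so no leading terms cancel. *)
Lemma size_second_entry_poly (F : fieldType) (p : nat) (a b : F) :
  prime p -> size (second_entry_poly F p a b) = (p ^ 2 - p + 2)%N.
Proof.
move=> p_pr; have p_gt1 := prime_gt1 p_pr.
have size_A : size (a%:P + 'X^p - 'X) = p.+1.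
  rewrite -addrA addrC -addrA size_polyDl ?size_polyXn //.
  rewrite ltnS (leq_trans (size_polyD _ _)) // size_polyN size_polyX geq_max.
  by rewrite p_gt1 (leq_trans (size_polyC_leq1 a)) // ltnW.
set A := a%:P + 'X^p - 'X in size_A *.
have A_neq0 : A != 0 by rewrite -size_poly_gt0 size_A.
have size_An i : size (A ^+ i) = (p * i).+1.
  by rewrite -[LHS]prednK ?size_exp ?size_A // size_poly_gt0 expf_neq0.
(* The summand i = p-1 has coefficient C(p, p-1)/p = 1, which does not vanish in characteristic
   p. *)
have top : witt_carry p A 'X = A ^+ p.-1 * 'X +
    \sum_(1 <= i < p.-1) A ^+ i * 'X ^+ (p - i) *+ ('C(p, i) %/ p).
  rewrite /witt_carry -[X in index_iota 1 X](prednK (prime_gt0 p_pr)).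
  rewrite big_nat_recr /=; last by lia.
  rewrite addrC.
  have -> : 'C(p, p.-1) = p by rewrite -subn1 bin_sub ?bin1 // ltnW.
  have -> : (p - p.-1 = 1)%N by lia.
  by rewrite divnn (prime_gt0 p_pr) expr1.
rewrite /second_entry_poly -/A top -!addrA size_polyDl.
  by rewrite size_mulX ?expf_neq0 // size_An; nia.
rewrite size_mulX ?expf_neq0 // size_An.
rewrite ltnS (leq_trans (size_polyD _ _)) // geq_max; apply/andP; split.
  (* For i <= p-2 the degree of A^i X^(p-i) is (p-1)i + p, at most p^2 - 2p + 2. *)
  rewrite big_nat; apply: leq_trans (size_sum _ _ _) _.
  apply/bigmax_leqP_seq => i _ /andP[i_gt0 i_lt].
  rewrite -scaler_nat; apply: leq_trans (size_scale_leq _ _) _.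
  by rewrite size_mulXn ?expf_neq0 // size_An; nia.
rewrite (leq_trans (size_polyD _ _)) // geq_max size_polyN; apply/andP; split.
  (* In the second carry the powers of X are X^(p(p-i)) with i >= 1, so the degree is at most
     p(p-1). *)
  rewrite /witt_carry big_nat; apply: leq_trans (size_sum _ _ _) _.
  apply/bigmax_leqP_seq => i _ /andP[i_gt0 i_lt].
  rewrite -scaler_nat; apply: leq_trans (size_scale_leq _ _) _.
  rewrite -exprM -rmorphXn /= mul_polyC.
  by apply: leq_trans (size_scale_leq _ _) _; rewrite size_polyXn; nia.
by apply: leq_trans (size_polyC_leq1 b) _.
Qed.

Lemma horner_second_entry_poly (F L : fieldType) (f : {rmorphism F -> L})
    (p : nat) (a b : F) (u : L) :
  (map_poly f (second_entry_poly F p a b)).[u] =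
  witt_carry p (f a + u ^+ p - u) u - witt_carry p (f a) (u ^+ p) + f b.
Proof.
(* Evaluation at [u] is a ring morphism, hence commutes with [witt_carry]. *)
rewrite -[LHS]/(horner_eval u _) /second_entry_poly.
rewrite !(rmorphD, rmorphN, rmorph_witt_carry, rmorphXn) /=.
by rewrite !(map_polyC, map_polyX) /= /horner_eval !hornerE.
Qed.

Theorem proposition7p1 (p : nat) (p_pr : prime p)
    (F : fieldType) (chF : p \in [pchar F]) (a b : F) :
  exists L : fieldExtType F,
    [/\ coprime (\dim {:L}) p,
        (\dim {:L} <= p ^ 2 - p + 1)%N
      & exists c : L,
          H1p2_map (in_alg L) (H1p2_class p_pr chF a b)
          = H1p2_class p_pr (rmorph_pchar (in_alg L) chF) c 0].
Proof.
have size_q := size_second_entry_poly F p a b p_pr.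
have deg_q : (size (second_entry_poly F p a b)).-1 = (p ^ 2 - p + 1)%N.
  by rewrite size_q addn2 addn1.
have co_q : coprime (size (second_entry_poly F p a b)).-1 p.
  have -> : (size (second_entry_poly F p a b)).-1 = ((p - 1) * p + 1)%N.
    by rewrite deg_q mulnBl mul1n.
  by rewrite /coprime gcdnC gcdnMDl gcdn1.
have [L [u [coL dimL u_root]]] := exists_root_coprime_degree _ _ _ p_pr co_q.
exists L; split; rewrite -?deg_q //.
(* This is the first entry of (a, b) + wp(u, 0). *)
exists (in_alg L a + u ^+ p - u).
rewrite H1p2_map_class; apply/esym/H1p2_eqP; exists (Witt2 p_pr u 0).
move/rootP: u_root; rewrite horner_second_entry_poly => u_root.
(* Moving terms across turns the goal into (u^p, 0) + (a, b) = (c, 0) + (u, 0), which avoids the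
   formula for Witt negation; the second entries agree exactly when [u] is a root. *)
apply/eqP; rewrite /witt2_wp subr_eq [eqbRHS]addrAC eq_sym subr_eq; apply/eqP.
congr Witt2 => /=; first by rewrite subrK addrC.
rewrite expr0n gtn_eqF ?prime_gt0 // !add0r; apply/eqP; rewrite -subr_eq0 opprK -{}u_root.
by rewrite (@witt_carryC _ _ (u ^+ p)) // addrC [X in _ + X == _]addrC addrA.
Qed.
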